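(* For $n\geq 0$ let $a_n$ be the number of even-up Catalan words of length $n$ and $b_n$ the number of odd-up Catalan words of length $n$, and let $A(x)=\sum_{n\geq 0}a_nx^n$, $B(x)=\sum_{n\geq 0}b_nx^n$. Then \[A(x)=\frac{2-x}{2x}-\frac{(2+x)\sqrt{(1+x)(1-3x)}}{2x(1+x)},\qquad B(x)=\frac{1-\sqrt{(1+x)(1-3x)}}{x(1+x)}.\]
   Context: A Catalan word of length $n$ is a word $w_1\cdots w_n\in\{1,\ldots,n\}^n$ with $w_1=1$ and $w_{i+1}\leq w_i+1$ for every $i\in\{1,\ldots,n-1\}$; for $n=0$ the empty word is the unique Catalan word. A word $w_1\cdots w_n$ is even-up if for every $i\in\{1,\ldots,n-1\}$, whenever $w_i$ is even, $w_{i+1}>w_i$; it is odd-up if for every $i\in\{1,\ldots,n-1\}$, whenever $w_i$ is odd, $w_{i+1}>w_i$. The square roots denote the power series branch with constant term $1$. *)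

(* Defs.v *)
From HB Require Import structures.
From mathcomp Require Import all_boot all_order all_algebra.
From mathcomp Require Import boolp classical_sets.

Set Implicit Arguments.
Unset Strict Implicit.
Unset Printing Implicit Defensive.

Import Order.TTheory GRing.Theory Num.Theory.
Local Open Scope nat_scope.

(* The default value of [head] makes the empty word a Catalan word. *)
Definition catalan_word (w : seq nat) : bool :=
  [&& all (fun a => 1 <= a <= size w) w, head 1 w == 1
    & sorted (fun a b => b <= a.+1) w].

Definition even_up (w : seq nat) : bool :=
  sorted (fun a b => ~~ odd a ==> (a < b)) w.

Definition odd_up (w : seq nat) : bool :=
  sorted (fun a b => odd a ==> (a < b)) w.

(* Letters range over {0, ..., n}; [catalan_word] excludes the letter 0. *)
Definition num_even_up (n : nat) : nat :=
  #|[set w : n.-tuple 'I_n.+1 |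
      catalan_word (map val w) && even_up (map val w)]|.

Definition num_odd_up (n : nat) : nat :=
  #|[set w : n.-tuple 'I_n.+1 |
      catalan_word (map val w) && odd_up (map val w)]|.

Local Open Scope ring_scope.

Record fps (R : Type) := Fps { fcoef : nat -> R }.
Arguments fcoef {R} f n%_N.

HB.instance Definition _ (R : Type) := gen_eqMixin (fps R).
HB.instance Definition _ (R : Type) := gen_choiceMixin (fps R).

Lemma fpsP (R : Type) (f g : fps R) : (forall n, fcoef f n = fcoef g n) -> f = g.
Proof. by case: f g => [f] [g] /= fg; congr Fps; apply: funext. Qed.

Section Zmod.
Context {R : zmodType}.
Implicit Types f g h : fps R.

Definition fps_zero : fps R := Fps (fun=> 0).
Definition fps_opp f : fps R := Fps (fun n => - fcoef f n).
Definition fps_add f g : fps R := Fps (fun n => fcoef f n + fcoef g n).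

Lemma fps_addA : associative fps_add.
Proof. by move=> f g h; apply: fpsP => n /=; rewrite addrA. Qed.
Lemma fps_addC : commutative fps_add.
Proof. by move=> f g; apply: fpsP => n /=; rewrite addrC. Qed.
Lemma fps_add0 : left_id fps_zero fps_add.
Proof. by move=> f; apply: fpsP => n /=; rewrite add0r. Qed.
Lemma fps_addN : left_inverse fps_zero fps_opp fps_add.
Proof. by move=> f; apply: fpsP => n /=; rewrite addNr. Qed.

HB.instance Definition _ :=
  GRing.isZmodule.Build (fps R) fps_addA fps_addC fps_add0 fps_addN.

Lemma fcoef0 n : fcoef (0 : fps R) n = 0. Proof. by []. Qed.
Lemma fcoefD f g n : fcoef (f + g) n = fcoef f n + fcoef g n. Proof. by []. Qed.
Lemma fcoefN f n : fcoef (- f) n = - fcoef f n. Proof. by []. Qed.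
End Zmod.

Section Ring.
Context {R : comNzRingType}.
Implicit Types f g h : fps R.

Definition fps_one : fps R := Fps (fun n => (n == 0%N)%:R).
Definition fps_mul f g : fps R :=
  Fps (fun n => \sum_(i < n.+1) fcoef f i * fcoef g (n - i)%N).

Let trunc N f : {poly R} := \poly_(i < N) fcoef f i.

Let coef_trunc N f i : (i < N)%N -> (trunc N f)`_i = fcoef f i.
Proof. by move=> iN; rewrite coef_poly iN. Qed.

Let coef_truncM N f g i : (i < N)%N ->
  (trunc N f * trunc N g)`_i = fcoef (fps_mul f g) i.
Proof.
move=> iN; rewrite coefM; apply: eq_bigr => j _.
rewrite !coef_trunc //; first exact: leq_ltn_trans (leq_subr _ _) iN.
by apply: leq_trans iN; rewrite ltn_ord.
Qed.

Lemma fps_mulC : commutative fps_mul.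
Proof.
by move=> f g; apply: fpsP => n; rewrite -!(@coef_truncM n.+1) // mulrC.
Qed.

Lemma fps_mulA : associative fps_mul.
Proof.
move=> f g h; apply: fpsP => n.
transitivity (trunc n.+1 f * (trunc n.+1 g * trunc n.+1 h))`_n.
  rewrite coefM; apply: eq_bigr => i _.
  by rewrite coef_trunc // coef_truncM // ltnS leq_subr.
rewrite mulrA coefM; apply: eq_bigr => i _.
by rewrite coef_truncM // coef_trunc // ltnS leq_subr.
Qed.

Lemma fps_mul1 : left_id fps_one fps_mul.
Proof.
move=> f; apply: fpsP => n /=; rewrite big_ord_recl /= mul1r subn0.
by rewrite big1 ?addr0 // => i _; rewrite mul0r.
Qed.

Lemma fps_mulDl : left_distributive fps_mul +%R.
Proof.
move=> f g h; apply: fpsP => n /=; rewrite -big_split.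
by apply: eq_bigr => i _; rewrite mulrDl.
Qed.

Lemma fps_one_neq0 : fps_one != 0.
Proof.
apply/eqP => /(congr1 (fun f : fps R => fcoef f 0)) /= /eqP.
by rewrite oner_eq0.
Qed.

HB.instance Definition _ := GRing.Zmodule_isComNzRing.Build (fps R)
  fps_mulA fps_mulC fps_mul1 fps_mulDl fps_one_neq0.

Lemma fcoef1 n : fcoef (1 : fps R) n = (n == 0%N)%:R. Proof. by []. Qed.
Lemma fcoefM f g n :
  fcoef (f * g) n = \sum_(i < n.+1) fcoef f i * fcoef g (n - i)%N.
Proof. by []. Qed.

Definition fpsX : fps R := Fps (fun n => (n == 1%N)%:R).

Definition fps_unit : {pred fps R} := fun f => `[< exists g, g * f = 1 >].
Definition fps_inv f : fps R := xget f [set g | g * f = 1].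

Lemma fps_mulV : {in fps_unit, left_inverse 1 fps_inv *%R}.
Proof.
by move=> f /asboolP fU; exact: (@xgetPex _ f [set g | g * f = 1] fU).
Qed.

Lemma fps_unitP f g : g * f = 1 -> fps_unit f.
Proof. by move=> gf; apply/asboolP; exists g. Qed.

Lemma fps_inv_out : {in [predC fps_unit], fps_inv =1 id}.
Proof.
move=> f /negP fU; apply: xgetPN => g gf.
by apply: fU; exact: fps_unitP gf.
Qed.

HB.instance Definition _ := GRing.ComNzRing_hasMulInverse.Build (fps R)
  fps_mulV fps_unitP fps_inv_out.
End Ring.

Section Domain.
Context {R : idomainType}.
Implicit Types f g : fps R.

Let valuation f : f <> 0 ->
  exists2 m, fcoef f m != 0 & forall i, (i < m)%N -> fcoef f i = 0.
Proof.
move=> f0; have ex : exists m, fcoef f m != 0.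
  apply: contrapT => nex; apply: f0; apply: fpsP => m; rewrite fcoef0.
  by apply/eqP/negPn/negP => fm; apply: nex; exists m.
case: (ex_minnP ex) => m fm mP; exists m => // i im.
by apply/eqP/negPn/negP => /mP; rewrite leqNgt im.
Qed.

Lemma fps_integral f g : f * g = 0 -> (f == 0) || (g == 0).
Proof.
move=> fg; apply/orP; case: (eqVneq f 0) => [|/eqP f0]; first by left.
case: (eqVneq g 0) => [|/eqP g0]; first by right.
have [m fm fP] := valuation f0; have [k gk gP] := valuation g0.
have := congr1 (fun h : fps R => fcoef h (m + k)) fg.
have mlt : (m < (m + k).+1)%N by rewrite ltnS leq_addr.
rewrite /= (bigD1 (Ordinal mlt)) //= addKn big1 => [|i im].
  by move/eqP; rewrite addr0 mulf_eq0 (negPf fm) (negPf gk).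
have [lt|lt|eq] := ltngtP i m; first by rewrite fP ?mul0r.
  by rewrite gP ?mulr0 // ltn_subLR ?ltn_add2r // -ltnS.
by case/eqP: im; apply: val_inj.
Qed.

HB.instance Definition _ :=
  GRing.ComUnitRing_isIntegral.Build (fps R) fps_integral.
End Domain.

(* The square root of [f] with constant term 1; the default value 0 is never
   used when [f] has constant term 1 and 2 is invertible, by [fps_sqrtP]. *)
Definition fps_sqrt (R : comNzRingType) (f : fps R) : fps R :=
  xget 0 [set s | s ^+ 2 = f /\ fcoef s 0 = 1].

Section SqrtTheory.
Context {F : fieldType} (two_neq0 : 2 != 0 :> F).
Implicit Types f s t : fps F.

Lemma fps_sqrt_uniq f s t : s ^+ 2 = f -> fcoef s 0 = 1 ->
  t ^+ 2 = f -> fcoef t 0 = 1 -> s = t.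
Proof.
move=> <- s0 /eqP; rewrite eqf_sqr => /orP[/eqP-> //|/eqP tE].
rewrite {}tE fcoefN s0 => /eqP.
by rewrite eq_sym -subr_eq0 opprK -[1 + 1]/(2%:R) (negPf two_neq0).
Qed.

Let sqrt_seq f := fix sqrt_seq n : seq F := if n is m.+1 then
    let s := sqrt_seq m in
    rcons s (if m == 0 then 1
             else (fcoef f m - \sum_(1 <= k < m) s`_k * s`_(m - k)) / 2)
  else [::].

Let size_sqrt_seq f n : size (sqrt_seq f n) = n.
Proof. by elim: n => //= n IHn; rewrite size_rcons IHn. Qed.

Let nth_sqrt_seq f n m : (n < m)%N -> (sqrt_seq f m)`_n = (sqrt_seq f n.+1)`_n.
Proof.
elim: m => // m IHm; rewrite ltnS leq_eqVlt => /orP[/eqP-> //|nm].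
by rewrite -IHm //= nth_rcons size_sqrt_seq nm.
Qed.

Lemma fps_sqrt_exists f : fcoef f 0 = 1 ->
  exists s, s ^+ 2 = f /\ fcoef s 0 = 1.
Proof.
move=> f0; exists (Fps (fun n => (sqrt_seq f n.+1)`_n)); split; last by [].
apply: fpsP => -[|m]; rewrite expr2 fcoefM.
  by rewrite big_ord_recl big_ord0 /= addr0 mulr1.
rewrite big_ord_recl big_ord_recr /= subn0 /bump /= add1n subnn.
rewrite mul1r mulr1 nth_rcons size_rcons size_sqrt_seq ltnn eqxx /=.
set s := rcons _ _; set S := \sum_(_ <= _ < _) _.
rewrite (_ : \sum_(i < m) _ = S); last first.
  rewrite /S big_add1 /= big_mkord; apply: eq_bigr => i _.
  rewrite add1n subSS.
  have E n : (n < m.+1)%N -> s`_n = (sqrt_seq f n.+1)`_n by exact: nth_sqrt_seq.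
  by rewrite !E // ltnS ?leq_subr.
by rewrite addrCA -mulrDl -mulr2n -[_ *+ 2]mulr_natr mulfK // addrC subrK.
Qed.

Lemma fps_sqrtP f : fcoef f 0 = 1 ->
  fps_sqrt f ^+ 2 = f /\ fcoef (fps_sqrt f) 0 = 1.
Proof.
move=> /fps_sqrt_exists.
exact: (@xgetPex _ 0 [set s | s ^+ 2 = f /\ fcoef s 0 = 1]).
Qed.
End SqrtTheory.

Definition gf_even_up : fps rat := Fps (fun n => (num_even_up n)%:R).
Definition gf_odd_up : fps rat := Fps (fun n => (num_odd_up n)%:R).

(* The right-hand sides divide by multiples of x, so the identities are stated
   in the field of fractions of the ring of power series (the field of Laurent
   series), into which power series embed. *)
Definition frac_of (f : fps rat) : {fraction (fps rat)} := tofrac f.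

(* Main.v *)
(* Given the current letter l, the next letter of the word lies in {1, ..., l+1}
   if l is free, and must be l+1 if l is restricted; starting from a virtual
   letter 0 produces exactly the words to be counted. Hence the generating
   functions F_l of the continuations of l are the unique solution of
   F_l = 1 + x (sum of F_b over the allowed b). Eliminating the restricted
   letters, the free letters satisfy
   K_{j+1} - K_j = x (K_{j+1} + 1 + x K_{j+2}), which is solved by
   (1 + x) K_j = d M^j - 1, where M = 1 + x M + x^2 M^2 is the Motzkin series
   and d is fixed by the boundary condition. *)
Require Import Defs.
From HB Require Import structures.
From mathcomp Require Import all_boot all_order all_algebra.
From mathcomp Require Import boolp classical_sets.
From mathcomp Require Import zify ring.
Import Order.TTheory GRing.Theory Num.Theory.
Local Open Scope ring_scope.

(** * Words as walks from the virtual letter [0] *)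

Definition step (r : pred nat) (l b : nat) : bool :=
  (1 <= b < l.+2)%N && (r l ==> (l < b)%N).

Fixpoint walks (r : pred nat) (n l : nat) : nat :=
  if n is m.+1 then (\sum_(1 <= b < l.+2 | r l ==> (l < b)%N) walks r m b)%N
  else 1%N.

Lemma card_tuple_cons (T : finType) (n : nat) (P : pred (seq T)) :
  #|[set w : n.+1.-tuple T | P w]|
    = (\sum_(b : T) #|[set w : n.-tuple T | P (b :: w)]|)%N.
Proof.
rewrite -sum1dep_card.
under [RHS]eq_bigr do rewrite -sum1dep_card.
rewrite pair_big_dep /=.
rewrite (reindex (fun p : T * n.-tuple T => [tuple of p.1 :: p.2])) //=.
exists (fun w => (thead w, [tuple of behead w])) => [[b w]|w] _.
  by congr pair; apply: val_inj.
by rewrite -tuple_eta.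
Qed.

(** Each step raises the letter by at most one, so [l + n < N] keeps every continuation inside the
    alphabet; induction on [n] splits off the first letter. *)
Lemma card_walks (r : pred nat) (N n l : nat) : (l + n < N)%N ->
  #|[set w : n.-tuple 'I_N | path (step r) l (map val w)]| = walks r n l.
Proof.
elim: n l => [|n IHn] l lN.
  rewrite (_ : [set _ | _] = [set [tuple]]) ?cards1 //.
  by apply/setP => w; rewrite !inE tuple0.
rewrite (card_tuple_cons _ _ (fun w => path (step r) l (map val w))) /=.
transitivity (\sum_(b < N | step r l b) walks r n b)%N.
  rewrite [RHS]big_mkcond; apply: eq_bigr => b _ /=; case: ifP => lb.
    rewrite -IHn; first by apply: eq_card => w; rewrite !inE.
    by case/andP: lb => /andP[_ lb _]; lia.
  by apply: eq_card0 => w; rewrite !inE.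
(* Both sums are extended to all [b] below [N], the range of [b] moving into the condition. *)
rewrite big_mkcond [RHS]big_mkcond (big_nat_widen _ _ N) /=; last by lia.
rewrite (big_nat_widenl 1 0) // -(big_mkord xpredT
  (fun b => if step r l b then walks r n b else 0%N)) [RHS]big_mkcond /=.
apply: eq_bigr => b _; rewrite /step.
by rewrite [in RHS]andbC; case: (_ && (_ < _)%N).
Qed.

Lemma path_stepE (r : pred nat) (l : nat) (w : seq nat) :
  path (step r) l w = [&& all (leq 1) w, path (fun a b => b <= a.+1)%N l w
                        & path (fun a b => r a ==> (a < b)%N) l w].
Proof.
elim: w l => //= b w IHw l; rewrite IHw /step ltnS.
by case: (0 < b)%N; case: (b <= l.+1)%N; case: (_ ==> _); rewrite /= ?andbF.
Qed.

Lemma path_step_bound (r : pred nat) (l : nat) (w : seq nat) :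
  path (step r) l w -> all (fun a => a <= l + size w)%N w.
Proof.
elim: w l => //= b w IHw l /andP[/andP[/andP[b1 bl] _] /IHw].
move=> bw; apply/andP; split; first by lia.
by apply: sub_all bw => a; lia.
Qed.

(** The only step from [0] leads to [1], whatever [r] is; this encodes the condition on the first
    letter. *)
Lemma catalan_word_path (r : pred nat) (w : seq nat) :
  catalan_word w && sorted (fun a b => r a ==> (a < b)%N) w
    = path (step r) 0 w.
Proof.
apply/idP/idP => [|w_step].
  case: w => //= b w; rewrite /catalan_word => /andP[/and3P[wb /eqP /= b1 wc]].
  move: wb wc; rewrite {}b1 => wb wc wr.
  rewrite {1}/step implybT /= path_stepE wc wr !andbT.
  by case/andP: wb => _; apply: sub_all => a /andP[].
(* The bound [size w] on the letters is automatic for a path from [0]. *)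
have := path_step_bound _ _ _ w_step; move: w_step; rewrite path_stepE add0n.
move=> /and3P[w1 wc wr] wn; apply/andP; split; last exact: path_sorted wr.
apply/and3P; split; last exact: path_sorted wc.
  by apply/allP => a aw; rewrite (allP w1) ?(allP wn).
by case: w w1 wc {wr wn} => //= b w /andP[b1 _] /andP[b0 _]; rewrite eqn_leq b0.
Qed.

Lemma num_even_up_walks (n : nat) :
  num_even_up n = walks (fun a => ~~ odd a) n 0.
Proof.
rewrite -(@card_walks _ n.+1) //; apply: eq_card => w.
by rewrite !inE catalan_word_path.
Qed.

Lemma num_odd_up_walks (n : nat) : num_odd_up n = walks odd n 0.
Proof.
rewrite -(@card_walks _ n.+1) //; apply: eq_card => w.
by rewrite !inE catalan_word_path.
Qed.

(** * Power series and the system for the continuations *)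

Lemma fcoefXM (R : comNzRingType) (f : fps R) (n : nat) :
  fcoef (fpsX * f) n = if n is m.+1 then fcoef f m else 0.
Proof.
rewrite fcoefM big_ord_recl /= mul0r add0r.
case: n => [|n]; first by rewrite big_ord0.
rewrite big_ord_recl /= mul1r subn1 /= big1 ?addr0 // => i _.
by rewrite /= mul0r.
Qed.

(** With this inverse, the division by [1 + x] in the formula for [K] stays within power series. *)
Lemma addX1_inverse (R : comNzRingType) :
  exists u : fps R, (1 + fpsX) * u = 1.
Proof.
exists (Fps (fun n => (-1) ^+ n)); apply: fpsP => n.
rewrite mulrDl mul1r fcoefD fcoefXM fcoef1.
by case: n => [|n] /=; rewrite ?addr0 // exprS mulN1r addNr.
Qed.

(** The factor [fpsX] makes coefficient [n + 1] depend only on coefficients [n], so any solution of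
    the system, however found, counts the walks. *)
Lemma walks_fcoef (R : comNzRingType) (r : pred nat) (F : nat -> fps R) :
  (forall l, F l = 1 + fpsX * \sum_(1 <= b < l.+2 | r l ==> (l < b)%N) F b) ->
  forall n l, fcoef (F l) n = (walks r n l)%:R.
Proof.
move=> FE; elim=> [|n IHn] l; rewrite FE fcoefD fcoef1 fcoefXM ?addr0 //=.
rewrite add0r natr_sum.
rewrite (big_morph (fun f : fps R => fcoef f n) (id1 := 0) (op1 := +%R)) //.
by apply: eq_bigr => b _; rewrite IHn.
Qed.

Lemma sum_restricted (V : nmodType) (F : nat -> V) (l : nat) :
  \sum_(1 <= b < l.+2 | (l < b)%N) F b = F l.+1.
Proof.
rewrite big_mkcond big_nat_recr //= ltnSn big_nat big1 ?add0r // => b /andP[_].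
by rewrite ltnS leqNgt => /negPf->.
Qed.

(** * Reduction of the system to the free letters *)

Section Recurrence.
Variables (R : comNzRingType) (K : nat -> fps R).
Let X : fps R := fpsX.
Hypothesis K_rec : forall j, K j.+1 = K j + X * (K j.+1 + 1 + X * K j.+2).

(** [K j] belongs to the free letter [2j+1]. Passing from [2j+1] to [2j+3] adds the successors
    [2j+3] and [2j+4], whose series [K j.+1] and [1 + X * K j.+2] give the increment in [K_rec]. *)
Lemma even_up_system (F : nat -> fps R) :
  K 0 = 1 + X * (K 0 + 1 + X * K 1) ->
  (forall l, F l = if odd l then K l./2 else 1 + X * K l./2) ->
  forall l,
    F l = 1 + X * \sum_(1 <= b < l.+2 | ~~ odd l ==> (l < b)%N) F b.
Proof.
move=> K0 FE l; case: (boolP (odd l)) => lo /=; last first.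
  by rewrite sum_restricted !FE /= (negPf lo) /= uphalf_half (negPf lo).
rewrite FE lo -[l in RHS]odd_double_half lo add1n.
elim: (l./2) => [|j IHj].
  by rewrite /index_iota /= !big_cons big_nil !FE /= {1}K0; ring.
rewrite doubleS; do 2 rewrite big_nat_recr //=; rewrite !FE /=.
rewrite !odd_double /= uphalf_double doubleK [LHS]K_rec.
by rewrite {1}IHj; ring.
Qed.

(** Now [K j] belongs to the free letter [2j], and the added successors are [2j+2] and [2j+3]. The
    boundary equation changes because [0] has the single successor [1]. *)
Lemma odd_up_system (F : nat -> fps R) :
  K 0 = 1 + X * (1 + X * K 1) ->
  (forall l, F l = if odd l then 1 + X * K l./2.+1 else K l./2) ->
  forall l, F l = 1 + X * \sum_(1 <= b < l.+2 | odd l ==> (l < b)%N) F b.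
Proof.
move=> K0 FE l; case: (boolP (odd l)) => lo /=.
  by rewrite sum_restricted !FE /= lo /= uphalf_half lo.
rewrite FE (negPf lo) -[l in RHS]odd_double_half (negPf lo) add0n.
elim: (l./2) => [|j IHj].
  by rewrite big_nat1 // !FE /= {1}K0.
rewrite doubleS; do 2 rewrite big_nat_recr //=; rewrite !FE /=.
rewrite !odd_double /= uphalf_double doubleK [LHS]K_rec.
by rewrite {1}IHj; ring.
Qed.
End Recurrence.

(** * Solving the recurrence with the Motzkin series *)

Section ClosedForm.
Variables (R : comNzRingType) (M u : fps R).
Let X : fps R := fpsX.
Hypotheses (M_quad : M = 1 + X * M + X ^+ 2 * M ^+ 2) (u_inv : (1 + X) * u = 1).

(** Ideal membership: it suffices to write [f - g] as a combination of the two relations, with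
    cofactors [a] and [b]. *)
Let combination0 (f g a b : fps R) :
  f - g = a * (M - (1 + X * M + X ^+ 2 * M ^+ 2)) + b * ((1 + X) * u - 1) ->
  f = g.
Proof.
by rewrite -M_quad u_inv !subrr !mulr0 addr0 => /eqP; rewrite subr_eq0 => /eqP.
Qed.

(** The characteristic equation is the Motzkin equation, so [u * d * M ^+ j] solves the homogeneous
    part; the constant [- u] is a particular solution. *)
Lemma closed_form_rec (d : fps R) (K := fun j => u * (d * M ^+ j - 1)) (j : nat) :
  K j.+1 = K j + X * (K j.+1 + 1 + X * K j.+2).
Proof.
apply: (combination0 _ _ (u * d * M ^+ j) X).
by rewrite /K !exprS; ring.
Qed.

Lemma even_up_closed_form (r := fun a => ~~ odd a) :
  (1 + X) * Fps (fun n => (walks r n 0)%:R) = 1 + X * (2 + X) * M.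
Proof.
(* The boundary equation is the recurrence at [j = -1] with value [1] there: [d / M - 1 = 1 + X], so
   [d = M * (2 + X)]. *)
pose K j := u * (M * (2 + X) * M ^+ j - 1).
pose F l := if odd l then K l./2 else 1 + X * K l./2.
have K0 : K 0%N = 1 + X * (K 0%N + 1 + X * K 1%N).
  by apply: (combination0 _ _ (u * (2 + X)) (1 + X)); rewrite /K; ring.
have FE := even_up_system _ _ (closed_form_rec _) F K0 (fun=> erefl).
rewrite (_ : Fps _ = F 0%N); last first.
  by apply: fpsP => n; rewrite (walks_fcoef _ r F FE).
apply: (combination0 _ _ 0 (X * (M * (2 + X) - 1))).
by rewrite /F /K /=; ring.
Qed.

Lemma odd_up_closed_form :
  (1 + X) * Fps (fun n => (walks odd n 0)%:R) = 1 + 2 * X * M.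
Proof.
(* The boundary equation reads [d * (1 - X ^+ 2 * M) = 2 * (1 + X)], and the Motzkin equation gives
   [(1 - X ^+ 2 * M) * (1 + X * M) = 1 + X]. *)
pose K j := u * (2 * (1 + X * M) * M ^+ j - 1).
pose F l := if odd l then 1 + X * K l./2.+1 else K l./2.
have K0 : K 0%N = 1 + X * (1 + X * K 1%N).
  by apply: (combination0 _ _ (2 * u * X) (1 + X)); rewrite /K; ring.
have FE := odd_up_system _ _ (closed_form_rec _) F K0 (fun=> erefl).
rewrite (_ : Fps _ = F 0%N); last first.
  by apply: fpsP => n; rewrite (walks_fcoef _ odd F FE).
apply: (combination0 _ _ 0 (1 + 2 * X * M)).
by rewrite /F /K /=; ring.
Qed.
End ClosedForm.

(** * The Motzkin series obtained from the square root *)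

Lemma motzkin_of_sqrt (F : fieldType) (X : fps F := fpsX)
    (s := fps_sqrt ((1 + X) * (1 - 3 * X))) : 2 != 0 :> F ->
  exists2 M, s = 1 - X - 2 * X ^+ 2 * M & M = 1 + X * M + X ^+ 2 * M ^+ 2.
Proof.
move=> two_neq0.
have qE : (1 + X) * (1 - 3 * X) = 1 - X * (2 + X * 3) by ring.
have q0 : fcoef ((1 + X) * (1 - 3 * X)) 0 = 1.
  by rewrite qE fcoefD fcoefN fcoefXM fcoef1 subr0.
have [s2 s0] := fps_sqrtP two_neq0 q0; rewrite -/s in s2 s0.
have s1 : fcoef s 1 = -1.
  have q1 : fcoef (1 - X * (2 + X * 3)) 1 = - 2.
    by rewrite fcoefD fcoefN fcoefXM fcoefD fcoefXM fcoef1 sub0r addr0.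
  move: (congr1 (fun f : fps F => fcoef f 1) s2); rewrite qE q1 expr2 fcoefM.
  rewrite !big_ord_recl big_ord0 /= s0 mul1r mulr1 addr0.
  by move=> e; apply: (mulfI two_neq0); rewrite mulrN1 -e; ring.
(* Since [s] begins with [1 - X], the shift by two loses nothing. *)
pose M : fps F := Fps (fun n => - fcoef s n.+2 / 2).
have sM : s = 1 - X - 2 * X ^+ 2 * M.
  rewrite (_ : 2 * X ^+ 2 * M = X * (X * (M + M))); last by ring.
  apply: fpsP => -[|[|n]]; rewrite !fcoefD !fcoefN !fcoefXM fcoef1 ?s0 ?s1 /=.
  - by rewrite !subr0.
  - by rewrite sub0r subr0.
  by field.
exists M => //; apply/eqP; rewrite -subr_eq0.
have X0 : X != 0.
  by apply/eqP => /(congr1 (fun f : fps F => fcoef f 1)) /eqP; rewrite /= oner_eq0.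
have two0 : 2 != 0 :> fps F.
  apply: contra two_neq0 => /eqP e; apply/eqP.
  exact: (congr1 (fun f : fps F => fcoef f 0) e).
(* The radicand is the discriminant of the Motzkin equation in [M], so squaring [s] yields that
   equation times [4 * X ^+ 2], which cancels in a domain. *)
have : 2 * 2 * X ^+ 2 * (M - (1 + X * M + X ^+ 2 * M ^+ 2)) == 0.
  move: s2; rewrite sM => /eqP; rewrite -subr_eq0 -oppr_eq0.
  by apply: etrans; congr (_ == 0); ring.
by rewrite !mulf_eq0 (negPf two0) (negPf X0).
Qed.

(** * Eliminating the Motzkin series in the field of fractions *)

Lemma solve_even_up (F : fieldType) (x m a : F) :
  2 != 0 :> F -> x != 0 -> 1 + x != 0 -> (1 + x) * a = 1 + x * (2 + x) * m ->
  a = (2 - x) / (2 * x)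
      - ((2 + x) * (1 - x - 2 * x ^+ 2 * m)) / (2 * x * (1 + x)).
Proof.
by move=> two0 x0 x1 aE; apply: (mulfI x1); rewrite aE; field; rewrite x1 x0 two0.
Qed.

Lemma solve_odd_up (F : fieldType) (x m b : F) :
  x != 0 -> 1 + x != 0 -> (1 + x) * b = 1 + 2 * x * m ->
  b = (1 - (1 - x - 2 * x ^+ 2 * m)) / (x * (1 + x)).
Proof.
by move=> x0 x1 bE; apply: (mulfI x1); rewrite bE; field; rewrite x1 x0.
Qed.

Theorem theorem10 :
  let X : fps rat := fpsX in
  let x := frac_of X in
  let s := frac_of (fps_sqrt ((1 + X) * (1 - 3 * X))) in
  frac_of gf_even_up
    = (2 - x) / (2 * x) - ((2 + x) * s) / (2 * x * (1 + x))
  /\ frac_of gf_odd_up = (1 - s) / (x * (1 + x)).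
Proof.
move=> X x s.
have [M sM M_quad] : exists2 M, _ & _ := @motzkin_of_sqrt rat isT.
have [u u_inv] := addX1_inverse rat.
have sE : s = 1 - x - 2 * x ^+ 2 * frac_of M.
  by rewrite /s sM /frac_of !(rmorphB, rmorphM, rmorphXn, rmorph1, rmorph_nat).
have AE : (1 + x) * frac_of gf_even_up = 1 + x * (2 + x) * frac_of M.
  rewrite (_ : gf_even_up = Fps (fun n => (walks (fun a => ~~ odd a) n 0)%:R)).
    have /(congr1 frac_of) := even_up_closed_form _ _ _ M_quad u_inv.
    by rewrite /frac_of !(rmorphD, rmorphM, rmorph1, rmorph_nat).
  by apply: fpsP => n; rewrite /= num_even_up_walks.
have BE : (1 + x) * frac_of gf_odd_up = 1 + 2 * x * frac_of M.
  rewrite (_ : gf_odd_up = Fps (fun n => (walks odd n 0)%:R)).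
    have /(congr1 frac_of) := odd_up_closed_form _ _ _ M_quad u_inv.
    by rewrite /frac_of !(rmorphD, rmorphM, rmorph1, rmorph_nat).
  by apply: fpsP => n; rewrite /= num_odd_up_walks.
have two0 : 2 != 0 :> {fraction (fps rat)}.
  rewrite -(rmorph_nat (@tofrac (fps rat))) tofrac_eq0.
  by apply/eqP => /(congr1 (fun f : fps rat => fcoef f 0)).
have x0 : x != 0.
  rewrite /x /frac_of tofrac_eq0.
  by apply/eqP => /(congr1 (fun f : fps rat => fcoef f 1)).
have x1 : 1 + x != 0.
  (* If [1 + x] vanished, the image of [(1 + X) * u = 1] would read [0 = 1]. *)
  apply/eqP => x1; move/(congr1 frac_of)/eqP: u_inv.
  by rewrite /frac_of rmorphM rmorphD !rmorph1 x1 mul0r eq_sym oner_eq0.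
by rewrite sE; split; [apply: solve_even_up AE | apply: solve_odd_up BE].
Qed.
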